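(* Consider the class of environments in which $V_t$ follows a Bernoulli distribution with mean $v$, and $F$ satisfies Assumption 1, $\phi_F'\le\lambda$ on $[0,1]$, and $0<c_f<f(b)<C_f$ for all $b\in[0,1]$ (for some constants $\lambda,c_f,C_f$). Suppose a bidding strategy satisfies, for every environment in this class, $R_T^{v,F}=O(T^a)$ for every $a>0$, and suppose there is $\gamma>0$ such that $\mathbb P(B_t<b^*_{v,F})<t^{-\gamma}$ for all $t$ in every such environment. Then in every such environment $$\liminf_{T\to\infty}\frac{R_T^{v,F}}{\log T}\ \ge\ c_f^2\lambda^2\,\frac{v(1-v)(v-b^*_{v,F})}{32}.$$
   Context: Model: at rounds $t=1,\dots,T$ a bidder submits $B_t\in[0,1]$, chosen as a function of past observations (and possibly of $F$). $(V_t)$ i.i.d. in $[0,1]$ with mean $v$; $(M_t)$ i.i.d. in $[0,1]$ with CDF $F$, independent of $(V_t)$. If $M_t\le B_t$ the bidder wins, pays $B_t$, receives and observes $V_t$; otherwise she does not observe $V_t$; $M_t$ is observed each round. $U_{v,F}(b)=(v-b)F(b)$, $b^*_{v,F}=\max\{\operatorname{argmax}_{b\in[0,1]}U_{v,F}(b)\}$, $R_T^{v,F}=T\max_bU_{v,F}(b)-\sum_{t=1}^T\mathbb E[U_{v,F}(B_t)]$. Assumption 1: $F$ is continuously differentiable with density $f$ and strictly log-concave ($f/F$ strictly decreasing on $(0,1)$). $\phi_F(b)=b+F(b)/f(b)$. *)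

(* Defs.v *)
From HB Require Import structures.
From mathcomp Require Import all_boot all_order all_algebra.
From mathcomp Require Import all_classical all_reals all_analysis.
Set Implicit Arguments. Unset Strict Implicit. Unset Printing Implicit Defensive.
Import Order.TTheory GRing.Theory Num.Theory.
Import numFieldNormedType.Exports.
Local Open Scope classical_set_scope.
Local Open Scope ring_scope.

Section Defs.
Variable R : realType.

(* One round's observation: the highest competing bid M_t (always observed)
   and, if the bidder won (M_t <= B_t), the value V_t in {0,1}
   (Some true = 1, Some false = 0); None = lost, value not observed. *)
Definition obs := (R * option bool)%type.
Definition history := seq obs.

(* A (deterministic) bidding strategy: the bid is a function of F and of the
   past observations. *)
Definition strategy := (R -> R) -> history -> R.

Definition U (v : R) (F : R -> R) (b : R) : R := (v - b) * F b.

Definition Umax (v : R) (F : R -> R) : R := sup [set U v F b | b in `[0, 1]].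

Definition bstar (v : R) (F : R -> R) : R :=
  sup [set b : R | b \in `[0, 1] /\
                   forall b', b' \in `[0, 1] -> U v F b' <= U v F b].

Definition phi (F f : R -> R) (b : R) : R := b + F b / f b.

(* The class of environments: V_t ~ Bernoulli(v), M_t has CDF F supported on
   [0,1] with density f, Assumption 1 (F C^1 with density f, f/F strictly
   decreasing on (0,1)), phi_F' <= lam, and c_f < f < C_f on [0,1]. *)
Definition env_class (lam cf Cf : R) (v : R) (F f : R -> R) : Prop :=
  (0 <= v <= 1) /\
  ((forall x : R, x < 0 -> F x = 0) /\ (forall x : R, 1 < x -> F x = 1) /\
   F 0 = 0 /\ F 1 = 1) /\
  ({within `[0, 1], continuous F} /\ {within `[0, 1], continuous f} /\
   (forall x : R, x \in `]0, 1[ -> is_derive x 1 F (f x))) /\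
  (forall x y : R, 0 < x -> x < y -> y < 1 -> f y / F y < f x / F x) /\
  (forall b : R, b \in `]0, 1[ ->
      derivable (phi F f) b 1 /\ 'D_1 (phi F f) b <= lam) /\
  (0 < cf /\ (forall b : R, b \in `[0, 1] -> cf < f b /\ f b < Cf)).

(* Expectation, over the remaining n rounds, of a functional g of the history
   at the end of these rounds, starting from history h, under environment
   (v, f) and bid rule sb (= strategy applied to F).  Each round: M ~ density
   f on [0,1]; if M <= bid the bidder wins and observes V ~ Bernoulli(v). *)
Fixpoint Exp (sb : history -> R) (v : R) (f : R -> R) (n : nat)
    (h : history) (g : history -> R) : R :=
  match n with
  | 0 => g h
  | n'.+1 =>
      Rintegral lebesgue_measure `[0, 1] (fun m : R =>
        f m * (if m <= sb h then
                 v * Exp sb v f n' (rcons h (m, Some true)) g +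
                 (1 - v) * Exp sb v f n' (rcons h (m, Some false)) g
               else Exp sb v f n' (rcons h (m, None)) g))
  end.

(* E[U_{v,F}(B_t)] for round t = k+1 (history of length k). *)
Definition expected_utility (s : strategy) v (F f : R -> R) (k : nat) : R :=
  Exp (s F) v f k [::] (fun h => U v F (s F h)).

Definition regret (s : strategy) v (F f : R -> R) (T : nat) : R :=
  T%:R * Umax v F - \sum_(k < T) expected_utility s v F f k.

(* P(B_t < b^*_{v,F}) for round t = k+1. *)
Definition prob_underbid (s : strategy) v (F f : R -> R) (k : nat) : R :=
  Exp (s F) v f k [::] (fun h => if s F h < bstar v F then 1 else 0).

Definition admissible (s : strategy) : Prop :=
  (forall F h, 0 <= s F h <= 1) /\
  (forall F (n : nat) (o : n.-tuple (option bool)),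
      measurable_fun setT (fun m : n.-tuple R => s F (zip m o))).

End Defs.

(* Main.v *)
(* The constant is immaterial: when 0 < v < 1 the underbidding constraint alone
   forces regret / log T -> +oo, and when v is 0 or 1 the bound is 0.

   Fix A > 0 and compare, at round t, the mean v with the mean
   w = v + sqrt (A / t).  The chi-square divergence between the two observation
   histories stays bounded, so Cauchy-Schwarz transfers the constraint at w,
   P_w (B_t < b^*_w) < t ^ (- gamma), to P_v (B_t < b^*_w) -> 0.  Bidding above
   b^*_w in environment v costs at least a multiple of (w - v) ^ 2 = A / t
   because phi is lam-Lipschitz.  Summing, the regret is eventually at least a
   multiple of A log T, with A arbitrary. *)
Require Import Defs.
From HB Require Import structures.
From mathcomp Require Import all_boot all_order all_algebra.
From mathcomp Require Import all_classical all_reals all_analysis.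
From mathcomp Require Import measurable_realfun.
From mathcomp Require Import zify ring lra.
Set Implicit Arguments. Unset Strict Implicit. Unset Printing Implicit Defensive.
Import Order.TTheory GRing.Theory Num.Theory.
Import numFieldNormedType.Exports.
Local Open Scope classical_set_scope.
Local Open Scope ring_scope.

(** No integrability is required: Tonelli treats the positive and negative parts separately, and
    [fine] is measurable. *)
Lemma measurable_Rintegral_section (d1 d2 : measure_display)
    (T1 : measurableType d1) (T2 : measurableType d2) (R : realType)
    (mu : {sigma_finite_measure set T2 -> \bar R}) (k : T1 * T2 -> R) :
  measurable_fun setT k ->
  measurable_fun setT (fun x => \int[mu]_y k (x, y)).
Proof.
move=> /measurable_EFinP mk.
rewrite /Rintegral; apply: (@measurableT_comp _ _ _ _ _ _ fine) => //.
rewrite (_ : (fun x => _) = (fun x => fubini_F mu (EFin \o k)^\+%E x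
                                    - fubini_F mu (EFin \o k)^\-%E x)%E).
  by apply: emeasurable_funB; apply: measurable_fun_fubini_tonelli_F => //;
    [exact: measurable_funepos|exact: measurable_funeneg].
by apply/funext => x; rewrite integralE; congr (_ - _)%E;
  apply: eq_integral => y _; rewrite ?funeposE ?funenegE.
Qed.

(** * Histories and a single round *)

Section expectation.
Context {R : realType}.
Implicit Types (g G : history R -> R) (h : history R) (C v b : R).

(** For each length and each pattern of outcomes, only the competing bids vary; this is the form in
    which [admissible] supplies measurability of the bids. *)
Definition hist_measurable g := forall (n : nat) (o : n.-tuple (option bool)),
  measurable_fun setT (fun m : n.-tuple R => g (zip m o)).

(** With [b := sb h] and [G] the expectation over the later rounds, this is the factor multiplying
    [f m] in [Exp]. *)
Definition round v b G h (m : R) :=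
  if m <= b then v * G (rcons h (m, Some true))
                 + (1 - v) * G (rcons h (m, Some false))
  else G (rcons h (m, None)).

Lemma rcons_zip n (o : n.-tuple (option bool)) (c : option bool)
    (ms : n.-tuple R) (m : R) :
  rcons (zip ms o) (m, c) = zip (rcons_tuple ms m) (rcons_tuple o c).
Proof. by rewrite /= zip_rcons // !size_tuple. Qed.

Lemma measurable_rcons n :
  measurable_fun setT (fun p : n.-tuple R * R => rcons_tuple p.1 p.2).
Proof.
apply/measurable_fun_tnthP => i.
have [ilt|ige] := ltnP i n.
- rewrite (_ : _ \o _ = fun p => tnth p.1 (Ordinal ilt)).
    by apply: (@measurableT_comp _ _ _ _ _ _ (fun x => tnth x (Ordinal ilt)));
      [exact: measurable_tnth|exact: measurable_fst].
  apply/funext => p /=.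
  rewrite (tnth_nth 0) (tnth_nth 0) /= nth_rcons size_tuple ilt //.
- rewrite (_ : _ \o _ = snd); first exact: measurable_snd.
  apply/funext => p /=; rewrite (tnth_nth 0) /= nth_rcons size_tuple.
  have -> : (i : nat) = n by apply/eqP; rewrite eqn_leq ige -ltnS ltn_ord.
  by rewrite ltnn eqxx.
Qed.

Lemma measurable_round v (sb : history R -> R) G n (o : n.-tuple (option bool)) :
  hist_measurable sb -> hist_measurable G ->
  measurable_fun setT (fun p : n.-tuple R * R =>
    round v (sb (zip p.1 o)) G (zip p.1 o) p.2).
Proof.
move=> msb mG.
have mGc c : measurable_fun setT
    (fun p : n.-tuple R * R => G (rcons (zip p.1 o) (p.2, c))).
  under eq_fun do rewrite rcons_zip.
  exact: (measurableT_comp (mG n.+1 (rcons_tuple o c)) (@measurable_rcons n)).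
apply: measurable_fun_ifT => //.
- apply: measurable_fun_ler; first exact: measurable_snd.
  exact: (measurableT_comp (msb n o) measurable_fst).
- by apply: measurable_funD; apply: measurable_funM => //.
Qed.

Lemma hist_zip h : exists (n : nat) (ms : n.-tuple R)
  (o : n.-tuple (option bool)), h = zip ms o.
Proof.
have sz : size (unzip2 h) == size h by rewrite size_map.
have sz1 : size (unzip1 h) == size h by rewrite size_map.
by exists (size h), (Tuple sz1), (Tuple sz); rewrite /= zip_unzip.
Qed.

(** Joint measurability with the past bids [ms] frozen; [b] is seen as a constant bid rule. *)
Lemma measurable_round_section v b G h : hist_measurable G ->
  measurable_fun setT (round v b G h).
Proof.
move=> mG; have [n [ms [oc ->]]] := hist_zip h.
pose F (p : n.-tuple R * R) := round v b G (zip p.1 oc) p.2.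
have mF : measurable_fun setT F.
  have mb : hist_measurable (fun=> b) by move=> ? ?; exact: measurable_cst.
  exact: (@measurable_round v _ _ _ oc mb mG).
exact: (measurableT_comp mF (pair1_measurable ms)).
Qed.

Lemma round_bounded v b G h C m : 0 <= v <= 1 -> (forall h, `|G h| <= C) ->
  `|round v b G h m| <= C.
Proof.
move=> /andP[v0 v1] GC; rewrite /round; case: ifPn => // _.
have := GC (rcons h (m, Some true)); have := GC (rcons h (m, Some false)).
rewrite !ler_norml => /andP[a1 a2] /andP[b1 b2]; apply/andP; split; nra.
Qed.


(** * Integration against a bounded probability density on [0, 1] *)

Section density.
Variables (f : R -> R) (K : R).
Hypothesis mf : measurable_fun `[0 : R, 1]%classic f.
Hypothesis f_bnd : forall x, x \in `[0 : R, 1] -> 0 <= f x <= K.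
Hypothesis f_int : \int[lebesgue_measure]_(x in `[0, 1]) f x = 1.

Definition mean (q : R -> R) : R :=
  \int[lebesgue_measure]_(m in `[0, 1]) (f m * q m).

Lemma mean_integrable (q : R -> R) C : measurable_fun setT q ->
  (forall m, `|q m| <= C) ->
  (@lebesgue_measure R).-integrable `[0 : R, 1]%classic (EFin \o (fun m => f m * q m)).
Proof.
move=> mq qC; apply: measurable_bounded_integrable => //=.
- by rewrite lebesgue_measure_itv/= lte_fin ltr01 oppr0 adde0 ltry.
- by apply: measurable_funM => //; exact: measurable_funTS.
- exists (K * C); split; first exact: num_real.
  move=> M ltM x xD; apply: le_trans (ltW ltM).
  have /andP[f0 fK] := f_bnd xD.
  by rewrite normrM ler_pM // ger0_norm.
Qed.

Lemma mean_cst a : mean (fun=> a) = a.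
Proof.
rewrite /mean RintegralZr ?f_int ?mul1r //.
have := @mean_integrable (cst 1) 1 (@measurable_cst _ _ _ _ _ _).
rewrite (_ : _ \o _ = EFin \o f); last by apply/funext => x /=; rewrite mulr1.
by apply=> m; rewrite normr1.
Qed.

Lemma mean_affine (q : R -> R) C a c : measurable_fun setT q ->
  (forall m, `|q m| <= C) -> mean (fun m => a + c * q m) = a + c * mean q.
Proof.
move=> mq qC; rewrite -[in RHS](mean_cst a) /mean.
have iq := mean_integrable mq qC.
have ia := @mean_integrable (cst a) `|a| (@measurable_cst _ _ _ _ _ _) (fun=> lexx _).
rewrite -RintegralZl // -RintegralD //; last first.
  rewrite (_ : _ \o _ = (fun m => c%:E * (f m * q m)%R%:E)%E).
    exact: integrableZl.
  by apply/funext => x /=; rewrite EFinM.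
by apply: eq_Rintegral => x _; rewrite mulrDr; congr (_ + _); rewrite mulrCA.
Qed.

Lemma le_mean (q1 q2 : R -> R) C1 C2 :
  measurable_fun setT q1 -> (forall m, `|q1 m| <= C1) ->
  measurable_fun setT q2 -> (forall m, `|q2 m| <= C2) ->
  (forall m, q1 m <= q2 m) -> mean q1 <= mean q2.
Proof.
move=> m1 b1 m2 b2 q12; apply: le_Rintegral => //.
- exact: mean_integrable b1.
- exact: mean_integrable b2.
- by move=> x xD; have /andP[f0 _] := f_bnd xD; rewrite ler_wpM2l.
Qed.

Lemma norm_mean (q : R -> R) C : measurable_fun setT q ->
  (forall m, `|q m| <= C) -> `|mean q| <= C.
Proof.
move=> mq qC.
have cb a (m : R) : `|(cst a : R -> R) m| <= `|a| by [].
have qC' m : - C <= q m <= C by rewrite -ler_norml.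
rewrite ler_norml -{1}(mean_cst (- C)) -{2}(mean_cst C); apply/andP; split.
- apply: (le_mean (measurable_cst _) (cb (- C)) mq qC).
  by move=> m; have /andP[] := qC' m.
- apply: (le_mean mq qC (measurable_cst _) (cb C)).
  by move=> m; have /andP[] := qC' m.
Qed.

Lemma measurable_sqr (q : R -> R) :
  measurable_fun setT q -> measurable_fun setT (fun m => q m ^+ 2).
Proof. by move=> mq; exact: measurable_funX. Qed.

(* Jensen, integrating the tangent-line bound [2 a x - a ^ 2 <= x ^ 2]. *)
Lemma sqr_mean_le (q : R -> R) C : measurable_fun setT q ->
  (forall m, `|q m| <= C) -> mean q ^+ 2 <= mean (fun m => q m ^+ 2).
Proof.
move=> mq qC; set a := mean q.
rewrite (_ : a ^+ 2 = mean (fun m => - a ^+ 2 + 2 * a * q m)); last first.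
  by rewrite (mean_affine _ _ mq qC) -/a; ring.
apply: (@le_mean _ _ (a ^+ 2 + `|2 * a| * C) (C ^+ 2)).
- by apply: measurable_funD => //; apply: measurable_funM.
- move=> m; apply: le_trans (ler_normD _ _) _.
  by rewrite normrN [`|a ^+ 2|]ger0_norm ?sqr_ge0 // lerD2l normrM ler_wpM2l.
- exact: measurable_sqr.
- by move=> m; rewrite normrX lerXn2r ?nnegrE // (le_trans (normr_ge0 _) (qC m)).
- by move=> m; have := sqr_ge0 (q m - a); nra.
Qed.

(** * Expectations over several rounds, and change of the mean value *)

Variable sb : history R -> R.
Hypothesis msb : hist_measurable sb.

Lemma Exp_S v n h g :
  Exp sb v f n.+1 h g = mean (round v (sb h) (fun h' => Exp sb v f n h' g) h).
Proof. by []. Qed.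

(** One joint induction, since bounding the integral of a round uses measurability of the later
    expectation. *)
Lemma Exp_measurable_bounded v g C n : 0 <= v <= 1 ->
  hist_measurable g -> (forall h, `|g h| <= C) ->
  hist_measurable (fun h => Exp sb v f n h g) /\
  (forall h, `|Exp sb v f n h g| <= C).
Proof.
move=> v01 mg gC; elim: n => [//|n [mG GC]]; split=> [k o|h].
- under eq_fun do rewrite Exp_S /mean Rintegral_mkcond.
  (* Extending [f] by zero turns the integral over [0, 1] into one over the line, with an integrand
     measurable on the whole product. *)
  pose k' (p : k.-tuple R * R) := (f \_ `[0, 1]%classic) p.2 *
    round v (sb (zip p.1 o)) (fun h' => Exp sb v f n h' g) (zip p.1 o) p.2.
  rewrite (_ : (fun m => _) =
      fun x => \int[lebesgue_measure]_y k' (x, y)).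
    apply: measurable_Rintegral_section; apply: measurable_funM.
      apply: (@measurableT_comp _ _ _ _ _ _ (f \_ `[0, 1]%classic)) => //.
      exact: (@measurable_restrictT _ _ _ _ `[0 : R, 1]%classic f (measurable_itv _)).1.
    exact: measurable_round.
  apply/funext => x; apply: eq_Rintegral => y _.
  by rewrite /k' /= !patchE; case: ifP => // _; rewrite mul0r.
- rewrite Exp_S; apply: norm_mean; first exact: measurable_round_section.
  by move=> m; exact: round_bounded.
Qed.

Lemma Exp_affine v g C n h a c : 0 <= v <= 1 ->
  hist_measurable g -> (forall h, `|g h| <= C) ->
  Exp sb v f n h (fun h => a + c * g h) = a + c * Exp sb v f n h g.
Proof.
move=> v01 mg gC; elim: n h => [//|n IH] h; rewrite !Exp_S.
have [mG GC] := Exp_measurable_bounded n v01 mg gC.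
rewrite -(@mean_affine _ C); last 2 first.
- exact: measurable_round_section.
- by move=> m; exact: round_bounded.
congr mean; apply/funext => m; rewrite /round !IH; case: ifP => // _; ring.
Qed.

Lemma le_Exp v g1 g2 C1 C2 n h : 0 <= v <= 1 ->
  hist_measurable g1 -> (forall h, `|g1 h| <= C1) ->
  hist_measurable g2 -> (forall h, `|g2 h| <= C2) ->
  (forall h, g1 h <= g2 h) -> Exp sb v f n h g1 <= Exp sb v f n h g2.
Proof.
move=> v01 m1 b1 m2 b2 g12; elim: n h => [//|n IH] h; rewrite !Exp_S.
have [mG1 GC1] := Exp_measurable_bounded n v01 m1 b1.
have [mG2 GC2] := Exp_measurable_bounded n v01 m2 b2.
apply: (@le_mean _ _ C1 C2).
- exact: measurable_round_section.
- by move=> m; exact: round_bounded.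
- exact: measurable_round_section.
- by move=> m; exact: round_bounded.
move=> m; rewrite /round; case: ifP => // _.
by case/andP: v01 => v0 v1; rewrite lerD // ler_wpM2l // subr_ge0.
Qed.

(* [E_w (dP_v / dP_w) ^ 2] for a single Bernoulli observation, i.e. one plus
   the chi-square divergence. *)
Definition bern_ratio v w := v ^+ 2 / w + (1 - v) ^+ 2 / (1 - w).

Lemma bern_ratioE v w : 0 < w < 1 ->
  bern_ratio v w = 1 + (v - w) ^+ 2 / (w * (1 - w)).
Proof. by case/andP=> w0 w1; rewrite /bern_ratio; field; lra. Qed.

Lemma bern_ratio_ge1 v w : 0 < w < 1 -> 1 <= bern_ratio v w.
Proof.
move=> w01; rewrite bern_ratioE // lerDl divr_ge0 ?sqr_ge0 // mulr_ge0 //; lra.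
Qed.

(** Lagrange's identity: the difference of the two sides is a square over [w * (1 - w)]. *)
Lemma bern_CS v w x y : 0 < w < 1 ->
  (v * x + (1 - v) * y) ^+ 2 <= bern_ratio v w * (w * x ^+ 2 + (1 - w) * y ^+ 2).
Proof.
case/andP=> w0 w1; rewrite -subr_ge0.
rewrite (_ : _ - _ = (v * (1 - w) * y - (1 - v) * w * x) ^+ 2 / (w * (1 - w))).
  by rewrite divr_ge0 ?sqr_ge0 // mulr_ge0 //; lra.
by rewrite /bern_ratio; field; lra.
Qed.

(* Cauchy-Schwarz for the likelihood ratio of the whole history, one round at a
   time. *)
Lemma sqr_Exp_le v w g C n h : 0 <= v <= 1 -> 0 < w < 1 ->
  hist_measurable g -> (forall h, `|g h| <= C) ->
  Exp sb v f n h g ^+ 2 <=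
  bern_ratio v w ^+ n * Exp sb w f n h (fun h => g h ^+ 2).
Proof.
move=> v01 w01 mg gC.
have w01' : 0 <= w <= 1 by lra.
have C0 : 0 <= C by exact: le_trans (normr_ge0 _) (gC h).
have mg2 : hist_measurable (fun h => g h ^+ 2).
  by move=> k o; apply: measurable_funX; exact: mg.
have gC2 h' : `|g h' ^+ 2| <= C ^+ 2 by rewrite normrX lerXn2r ?nnegrE.
have r1 := bern_ratio_ge1 v w01; set r := bern_ratio v w in r1 *.
elim: n h => [|n IH] h; first by rewrite expr0 mul1r.
rewrite !Exp_S.
have [mG GC] := Exp_measurable_bounded n v01 mg gC.
have [mH HC] := Exp_measurable_bounded n w01' mg2 gC2.
have mq := measurable_round_section v (sb h) h mG.
have qC m := round_bounded (sb h) h m v01 GC.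
have mq' := measurable_round_section w (sb h) h mH.
have qC' m := round_bounded (sb h) h m w01' HC.
(* The competing bid has the same density under both means, so Jensen handles it; only the value bit
   costs a factor [r]. *)
apply: le_trans (sqr_mean_le mq qC) _.
rewrite -[leRHS]add0r -(mean_affine 0 _ mq' qC').
apply: (@le_mean _ _ (C ^+ 2) (r ^+ n.+1 * C ^+ 2)).
- exact: measurable_sqr.
- by move=> m; rewrite normrX lerXn2r ?nnegrE.
- by apply: measurable_funD => //; exact: measurable_funM.
- move=> m; rewrite add0r normrM ger0_norm ?ler_wpM2l ?exprn_ge0 //; lra.
move=> m; rewrite add0r /round; case: ifP => _.
- apply: le_trans (bern_CS v _ _ w01) _.
  rewrite [r ^+ _]exprS -mulrA -/r ler_wpM2l ?(le_trans ler01) //.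
  rewrite mulrDr (mulrCA _ w) (mulrCA _ (1 - w)).
  by apply: lerD; apply: ler_wpM2l; rewrite ?IH //; lra.
(* A lost round carries no information on the mean; its factor [r] is spare and [1 <= r]. *)
- apply: le_trans (IH _) _; rewrite [r ^+ _.+1]exprS -mulrA ler_peMl //.
  exact: le_trans (sqr_ge0 _) (IH _).
Qed.

End density.
End expectation.

(** * The shape of [phi] and of the utility in one environment *)

Section environment.
Context {R : realType}.
Variables (lam cf Cf v0 : R) (F f : R -> R).
Hypothesis env : env_class lam cf Cf v0 F f.

Let F0 : F 0 = 0. Proof. by case: env => _ [[_ [_ []]]]. Qed.
Let F1 : F 1 = 1. Proof. by case: env => _ [[_ [_ []]]]. Qed.
Let contF : {within `[0, 1], continuous F}.
Proof. by case: env => _ [_ [[]]]. Qed.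
Let contf : {within `[0, 1], continuous f}.
Proof. by case: env => _ [_ [[_ []]]]. Qed.
Let dF (x : R) : x \in `]0, 1[ -> is_derive x 1 F (f x).
Proof. by case: env => _ [_ [[_ [_ +]]]] _; apply. Qed.
Let logconc (x y : R) : 0 < x -> x < y -> y < 1 -> f y / F y < f x / F x.
Proof. by case: env => _ [_ [_ [+ _]]]; apply. Qed.
Let dphi (x : R) : x \in `]0, 1[ -> derivable (phi F f) x 1 /\ 'D_1 (phi F f) x <= lam.
Proof. by case: env => _ [_ [_ [_ [+ _]]]]; apply. Qed.
Let cf0 : 0 < cf. Proof. by case: env => _ [_ [_ [_ [_ []]]]]. Qed.
Let fb (b : R) : b \in `[0, 1] -> cf < f b /\ f b < Cf.
Proof. by case: env => _ [_ [_ [_ [_ [_ +]]]]]; apply. Qed.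

Lemma env_density_gt0 (b : R) : 0 <= b <= 1 -> 0 < f b.
Proof. by move=> b01; case: (@fb b) => [|/(lt_trans cf0)//]; rewrite in_itv. Qed.

Lemma within01_subset (g : R -> R) x y : 0 <= x -> y <= 1 ->
  {within `[0, 1], continuous g} -> {within `[x, y], continuous g}.
Proof.
move=> x0 y1; apply: continuous_subspaceW => z /=.
by rewrite !in_itv /= => /andP[xz zy]; rewrite (le_trans x0 xz) (le_trans zy y1).
Qed.

Lemma env_cdf_gt0 (x : R) : 0 < x <= 1 -> 0 < F x.
Proof.
case/andP=> x0 x1.
have [||c /[!in_itv]/= /andP[c0 cx]] := @MVT _ F f 0 x x0.
- move=> z /[!in_itv]/= /andP[z0 zx]; apply: dF; rewrite in_itv /= z0 /=.
  exact: lt_le_trans zx x1.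
- exact: within01_subset.
rewrite F0 !subr0 => ->; rewrite mulr_gt0 // env_density_gt0 //; lra.
Qed.

Lemma phi_within_continuous : {within `[0, 1], continuous (phi F f)}.
Proof.
move/subspace_continuousP : contF => cF; move/subspace_continuousP : contf => cf_.
apply/subspace_continuousP => x xD; apply: cvgD.
  exact: cvg_within.
apply: cvgM; first exact: cF.
apply: cvgV; last exact: cf_.
by apply: lt0r_neq0; apply: env_density_gt0; move: xD; rewrite /= in_itv.
Qed.

(** [F / f] is the inverse of [f / F], which decreases strictly by log-concavity. *)
Lemma phi_lt (x y : R) : 0 < x -> x < y -> y < 1 -> phi F f x < phi F f y.
Proof.
move=> x0 xy y1; have Fx : 0 < F x by apply: env_cdf_gt0; lra.
have Fy : 0 < F y by apply: env_cdf_gt0; lra.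
have fx : 0 < f x by apply: env_density_gt0; lra.
have fy : 0 < f y by apply: env_density_gt0; lra.
rewrite /phi ltrD // -invf_div -[ltRHS]invf_div ltf_pV2 ?posrE ?divr_gt0 //.
exact: logconc.
Qed.

Lemma phi_lipschitz (x y : R) : 0 <= x -> x <= y -> y <= 1 ->
  phi F f y - phi F f x <= lam * (y - x).
Proof.
rewrite (le_eqVlt x y) => x0 /predU1P[->|xy] y1; first by rewrite !subrr mulr0.
have in01 z : z \in `]x, y[ -> z \in `]0, 1[.
  rewrite !in_itv /= => /andP[xz zy].
  by rewrite (le_lt_trans x0 xz) (lt_le_trans zy y1).
have [||c cxy ->] := @MVT _ (phi F f) (fun z => 'D_1 (phi F f) z) x y xy.
- by move=> z /in01 /dphi[dz _]; exact: derivableP.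
- exact: within01_subset phi_within_continuous.
by apply: ler_wpM2r; [rewrite subr_ge0 ltW|case: (dphi (in01 _ cxy))].
Qed.

Lemma phi0 : phi F f 0 = 0.
Proof. by rewrite /phi F0 mul0r addr0. Qed.

Lemma phi1_gt1 : 1 < phi F f 1.
Proof. by rewrite /phi F1 ltrDl div1r invr_gt0 env_density_gt0 // ler01 lexx. Qed.

(** [phi] climbs from 0 to above 1 over the unit interval. *)
Lemma lam_gt0 : 0 < lam.
Proof.
have := @phi_lipschitz 0 1 (lexx _) ler01 (lexx _).
by rewrite phi0 !subr0 mulr1; have := phi1_gt1; lra.
Qed.

(** The derivative of [U v F] is [(v - phi F f c) * f c], so its sign is that of [v - phi F f c]. *)
Lemma U_MVT (v x y : R) : 0 <= x -> x < y -> y <= 1 ->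
  exists2 c, x < c < y &
    U v F y - U v F x = (v - phi F f c) * f c * (y - x).
Proof.
move=> x0 xy y1.
have [||c cxy ->] := @MVT _ (U v F) (fun z => (v - phi F f z) * f z) x y xy.
- move=> z /[!in_itv]/= /andP[xz zy].
  have dFz : is_derive z 1 F (f z) by apply: dF; rewrite in_itv /=; lra.
  have fz : f z != 0 by apply/lt0r_neq0/env_density_gt0; lra.
  have dvz : is_derive z 1 (cst v - id : R -> R) (0 - 1) by apply: is_deriveB.
  apply: (is_derive_eq (is_deriveM dvz dFz)).
  rewrite /phi /GRing.scale /= (_ : (cst v - id) z = v - z) //; field => //.
- apply: within01_subset => //.
  move/subspace_continuousP : contF => cF.
  apply/subspace_continuousP => z zD; apply: cvgM; last exact: cF.
  by apply: cvgB; [exact: cvg_cst|exact: cvg_within].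
by exists c; rewrite // -in_itv.
Qed.

(** Intermediate values between [phi] = 0 at 0 and [phi] > 1 at 1, then strict monotonicity for the
    signs. *)
Lemma phi_preimage (v : R) : 0 <= v <= 1 -> exists b, [/\ 0 <= b < 1, phi F f b = v,
  forall c, 0 < c < b -> phi F f c < v & forall c, b < c < 1 -> v < phi F f c].
Proof.
move=> /andP[v_ge0 v_le1].
have [|b /[!in_itv]/= /andP[b0 b1] bv] :=
    @IVT _ (phi F f) 0 1 v ler01 phi_within_continuous.
  have phi1 := phi1_gt1; have phi1_ge0 : 0 <= phi F f 1 by lra.
  by rewrite phi0 (min_l phi1_ge0) (max_r phi1_ge0); lra.
have b_lt1 : b < 1.
  rewrite lt_neqAle b1 andbT; apply/eqP => b1E.
  by have := phi1_gt1; rewrite -b1E bv; lra.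
exists b; split=> //; first by rewrite b0.
  by move=> c /andP[c0 cb]; rewrite -bv phi_lt.
move=> c /andP[bc c1]; rewrite -bv.
have [b_gt0|] := ltP 0 b; first exact: phi_lt.
(* [phi_lt] needs a positive left end; at [b] = 0 the claim is positivity of [phi]. *)
move=> b_le0; have -> : b = 0 by lra.
have c0 : 0 < c by lra.
rewrite phi0 /phi addr_gt0 // divr_gt0 //.
  by apply: env_cdf_gt0; lra.
by apply: env_density_gt0; lra.
Qed.

Lemma U_unimodal (v b : R) : 0 <= b < 1 ->
  (forall c, 0 < c < b -> phi F f c < v) ->
  (forall c, b < c < 1 -> v < phi F f c) ->
  forall x, 0 <= x <= 1 -> x != b -> U v F x < U v F b.
Proof.
move=> b01 lo hi x x01 xb; have [xltb|bltx|xbE] := ltgtP x b.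
- have [|||c cxb] := @U_MVT v x b; rewrite //; try lra.
  move=> e; rewrite -subr_gt0 e mulr_gt0 ?subr_gt0 // mulr_gt0 ?subr_gt0 //.
    by apply: lo; lra.
  by apply: env_density_gt0; lra.
- have [|||c cxb] := @U_MVT v b x; rewrite //; try lra.
  move=> e; rewrite -subr_lt0 e nmulr_rlt0 ?subr_gt0 // nmulr_rlt0 ?subr_lt0.
    by apply: env_density_gt0; lra.
  by apply: hi; lra.
- by rewrite xbE eqxx in xb.
Qed.

(** The utility at the preimage of [v] under [phi] bounds the set, so that its [sup] is not a
    default value. *)
Lemma U_le_Umax (v x : R) : 0 <= v <= 1 -> 0 <= x <= 1 -> U v F x <= Umax v F.
Proof.
move=> v01 x01; have [b [b01 _ lo hi]] := phi_preimage v01.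
apply: ub_le_sup; last by exists x; rewrite //= in_itv.
exists (U v F b) => _ [y /= /[!in_itv]/= y01 <-].
have [->//|yb] := eqVneq y b.
exact/ltW/U_unimodal.
Qed.

(** By [U_unimodal] the argmax is a singleton, so the [sup] in [bstar] is the preimage of [v] under
    [phi]. *)
Lemma bstarP (v : R) : 0 <= v <= 1 ->
  [/\ 0 <= bstar v F < 1, phi F f (bstar v F) = v
    & forall c, bstar v F < c < 1 -> v < phi F f c].
Proof.
move=> v01; have [b [b01 bv lo hi]] := phi_preimage v01.
suff -> : bstar v F = b by [].
rewrite /bstar (_ : [set _ | _] = [set b]) ?sup1 //.
apply/seteqP; split=> [x /= [x01 xmax]|_ ->] /=.
  apply/eqP/negPn/negP => xb; move: x01; rewrite in_itv /= => x01.
  have := U_unimodal b01 lo hi x01 xb; rewrite ltNge xmax //.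
  by rewrite in_itv /=; lra.
split=> [|y /[!in_itv]/= y01]; first by rewrite in_itv /=; lra.
have [->//|yb] := eqVneq y b.
exact/ltW/U_unimodal.
Qed.

(* On the interval of length [d / (2 lam)] to the left of [bstar (v + d)],
   [phi] exceeds [v] by at least [d / 2], so [U v F] decreases at rate at least
   [cf * d / 2]; to the right it keeps decreasing. *)
Lemma U_overbid (v d b : R) : 0 <= v -> 0 < d -> v + d <= 1 -> 0 <= b <= 1 ->
  bstar (v + d) F <= b -> U v F b <= Umax v F - cf / (4 * lam) * d ^+ 2.
Proof.
move=> v_ge0 d0 vd1 b01; have [|] := @bstarP (v + d); first by lra.
set b' := bstar _ _ => b'01 b'v hi b'b.
(* Slope [cf * d / 2] times length [eta] yields the loss [cf / (4 * lam) * d ^+ 2]. *)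
have lam0 := lam_gt0; pose eta := d / (2 * lam).
have eta0 : 0 < eta by rewrite divr_gt0 // mulr_gt0.
have lam_eta : lam * eta = d / 2 by rewrite /eta; field; lra.
(* The interval stays inside [0, 1]: [phi] climbs from 0 to [v + d] on [0, [b']], so [lam * b'] is
   at least [d]. *)
have etab : eta <= b'.
  have := @phi_lipschitz 0 b'; rewrite phi0 b'v !subr0 => /(_ (lexx _)) h.
  rewrite -(ler_pM2l lam0) lam_eta; apply: le_trans (h _ _); lra.
have Ub : U v F b <= U v F b'.
  move: b'b; rewrite le_eqVlt => /predU1P[->//|b'b].
  have [|||c cxb] := @U_MVT v b' b; rewrite //; try lra.
  move=> e; rewrite -subr_le0 e; apply: mulr_le0_ge0; last by lra.
  apply: mulr_le0_ge0; first by have := hi c; lra.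
  by apply/ltW/env_density_gt0; lra.
apply: le_trans Ub _.
have UM : U v F (b' - eta) <= Umax v F by apply: U_le_Umax; lra.
have [|||c cxb] := @U_MVT v (b' - eta) b'; rewrite //; try lra.
move=> e.
have phic : v + d / 2 <= phi F f c.
  have h : phi F f b' - phi F f c <= lam * (b' - c) by apply: phi_lipschitz; lra.
  have : lam * (b' - c) <= lam * eta by rewrite ler_pM2l //; lra.
  by rewrite lam_eta; lra.
have [|fc _] := @fb c; first by rewrite in_itv /=; lra.
suff : U v F b' - U v F (b' - eta) <= - (cf / (4 * lam) * d ^+ 2) by lra.
rewrite e subKr.
have -> : - (cf / (4 * lam) * d ^+ 2) = - (d / 2) * cf * eta.
  by rewrite /eta; field; lra.
rewrite ler_pM2r //.
have fc0 : 0 <= f c by exact/ltW/(lt_trans cf0).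
have : 0 <= (phi F f c - v - d / 2) * f c by rewrite mulr_ge0 // subr_ge0; lra.
have : 0 <= d / 2 * (f c - cf) by rewrite mulr_ge0 ?subr_ge0; lra.
lra.
Qed.


Lemma env_density_measurable : measurable_fun `[0 : R, 1]%classic f.
Proof. exact: subspace_continuous_measurable_fun. Qed.

Lemma env_density_bounded (x : R) : x \in `[0 : R, 1] -> 0 <= f x <= Cf.
Proof. by move=> /fb[cfx /ltW ->]; rewrite (ltW (lt_trans cf0 cfx)). Qed.

Lemma env_density_integral : \int[lebesgue_measure]_(x in `[0, 1]) f x = 1.
Proof.
have [_ Fr Fl] := (continuous_within_itvP F (@ltr01 R)).1 contF.
rewrite /Rintegral (@continuous_FTC2 _ f F) ?ltr01 //.
- by rewrite F0 F1 -EFinB subr0.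
- by split=> // x /dF[].
- by move=> x /dF dFx; rewrite derive1E; exact: derive_val.
Qed.

Lemma env_U_bounded (v b : R) : 0 <= v <= 1 -> 0 <= b <= 1 -> `|U v F b| <= 1.
Proof.
move=> v01 b01; rewrite normrM -[leRHS]mulr1 ler_pM //.
  by rewrite ler_norml; lra.
have [b0|b_le0] := ltP 0 b; last first.
  by have -> : b = 0; [lra|rewrite F0 normr0].
rewrite ger0_norm; last by apply/ltW/env_cdf_gt0; lra.
have [b1|b_ge1] := ltP b 1; last by have -> : b = 1; [lra|rewrite F1].
have [||c cb] := @MVT _ F f b 1 b1.
- by move=> z /[!in_itv]/= ?; apply: dF; rewrite in_itv /=; lra.
- by apply: within01_subset => //; lra.
rewrite in_itv /= in cb; rewrite F1 => e.
suff : 0 <= 1 - F b by lra.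
by rewrite e mulr_ge0 //; [apply/ltW/env_density_gt0; lra|lra].
Qed.

(** * Per-round loss of a bid rule *)

Variable sb : history R -> R.
Hypothesis msb : hist_measurable sb.
Hypothesis sb01 : forall h, 0 <= sb h <= 1.

Lemma env_U_measurable (v : R) : hist_measurable (fun h => U v F (sb h)).
Proof.
move=> n o; apply: measurable_funM.
  by apply: measurable_funB => //; exact: msb.
have mF : measurable_fun `[0 : R, 1]%classic F.
  exact: subspace_continuous_measurable_fun.
apply: (measurable_comp (measurable_itv `[0 : R, 1]) _ mF (msb o)).
by move=> _ [m _ <-] /=; rewrite in_itv /=.
Qed.

(** The threshold is independent of the mean: bidding below the optimum for one mean must be
    measured under another. *)
Definition underbid (c : R) (h : history R) : R := if sb h < c then 1 else 0.

Lemma underbid_measurable (c : R) : hist_measurable (underbid c).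
Proof.
move=> n o; apply: measurable_fun_ifT => //.
by apply: measurable_fun_ltr => //; exact: msb.
Qed.

Lemma underbid_bounded (c : R) h : `|underbid c h| <= 1.
Proof. by rewrite /underbid; case: ifP => _; rewrite ?normr1 ?normr0. Qed.

Let Exp_aff := Exp_affine env_density_measurable env_density_bounded
  env_density_integral msb.
Let Exp_le := le_Exp env_density_measurable env_density_bounded
  env_density_integral msb.

Lemma Exp_U_le_Umax (v : R) k : 0 <= v <= 1 ->
  Exp sb v f k [::] (fun h => U v F (sb h)) <= Umax v F.
Proof.
move=> v01; have mu := underbid_measurable 0; have ub := underbid_bounded 0.
(* The constant [Umax v F] is an affine image with slope 0 of a bounded measurable function, so
   [Exp_affine] evaluates its expectation. *)
have := Exp_aff k [::] (Umax v F) 0 v01 mu ub; rewrite mul0r addr0 => <-.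
apply: (Exp_le _ _ v01 (env_U_measurable v) _ _ (C1 := 1) (C2 := `|Umax v F|)).
- by move=> h; exact: env_U_bounded.
- by move=> n o; apply: measurable_funD => //; apply: measurable_funM => //;
    exact: mu.
- by move=> h; rewrite mul0r addr0.
- by move=> h; rewrite mul0r addr0; exact: U_le_Umax.
Qed.

(** Take expectations in the pointwise bound of the utility by [Umax v F - e + e * underbid c h],
    which is [U_le_Umax] below the threshold and [U_overbid] above it. *)
Lemma Exp_U_overbid (v d : R) k : 0 <= v -> 0 < d -> v + d <= 1 ->
  cf / (4 * lam) * d ^+ 2 *
    (1 - Exp sb v f k [::] (underbid (bstar (v + d) F))) <=
  Umax v F - Exp sb v f k [::] (fun h => U v F (sb h)).
Proof.
move=> v0' d0 vd1; set c := bstar _ _; set e := cf / _ * _.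
have v01 : 0 <= v <= 1 by lra.
have mu := underbid_measurable c; have ub := underbid_bounded c.
have e0 : 0 <= e.
  by rewrite mulr_ge0 ?sqr_ge0 // divr_ge0 // ?mulr_ge0 // ltW // lam_gt0.
suff : Exp sb v f k [::] (fun h => U v F (sb h)) <=
       (Umax v F - e) + e * Exp sb v f k [::] (underbid c) by nra.
rewrite -(Exp_aff _ _ _ _ v01 mu ub).
apply: (Exp_le _ _ v01 (env_U_measurable v) _ _
         (C1 := 1) (C2 := `|Umax v F - e| + e)).
- by move=> h; exact: env_U_bounded.
- by move=> n o; apply: measurable_funD => //; apply: measurable_funM => //;
    exact: mu.
- move=> h; apply: le_trans (ler_normD _ _) _; rewrite lerD2l normrM ger0_norm //.
  by rewrite ler_piMr.
move=> h; rewrite /underbid; have [_|cs] := ltP (sb h) c.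
  by rewrite mulr1 subrK U_le_Umax.
by rewrite mulr0 addr0 U_overbid.
Qed.

(** An indicator equals its square, so the second moment in [sqr_Exp_le] is again a probability. *)
Lemma underbid_change_of_measure (v w c : R) k : 0 <= v <= 1 -> 0 < w < 1 ->
  Exp sb v f k [::] (underbid c) ^+ 2 <=
  bern_ratio v w ^+ k * Exp sb w f k [::] (underbid c).
Proof.
move=> v01 w01.
have := sqr_Exp_le env_density_measurable env_density_bounded
  env_density_integral msb k [::] v01 w01 (underbid_measurable c)
  (underbid_bounded c).
rewrite (_ : (fun h => _) = underbid c) //; apply/funext => h.
by rewrite /underbid; case: ifP => _; rewrite ?expr1n ?expr0n.
Qed.

(* With [d ^ 2 = A / (k + 1)] the likelihood ratio between the means [v] and
   [v + d] stays bounded, so a bid rule which rarely underbids at mean [v + d]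
   must exceed [bstar (v + d)] at mean [v] with probability at least [1/2]. *)
Lemma Exp_U_gap (v gamma A : R) : 0 < v < 1 -> 0 < gamma -> 0 < A ->
  (forall w k, 0 <= w <= 1 ->
    Exp sb w f k [::] (underbid (bstar w F)) < k.+1%:R `^ (- gamma)) ->
  exists N : nat, forall k, (N <= k)%N ->
    cf / (8 * lam) * A / k.+1%:R <=
    Umax v F - Exp sb v f k [::] (fun h => U v F (sb h)).
Proof.
move=> /andP[v_gt0 v_lt1] gamma0 A0 ubP.
(* For [d <= d0], [q] bounds [w * (1 - w)] from below at [w = v + d]. Beyond [N1] one has [d <= d0];
   beyond [N2] the power of [t] beats [expR (A / q)] by a factor 4. *)
pose q := v * (1 - v) / 2; have q0 : 0 < q by rewrite divr_gt0 // mulr_gt0 //; lra.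
pose d0 := (1 - v) / 2; have d00 : 0 < d0 by rewrite /d0; lra.
pose N1 := A / d0 ^+ 2; pose N2 := expR ((A / q + ln 4) / gamma).
have N10 : 0 < N1 by rewrite divr_gt0 // exprn_gt0.
have N20 : 0 < N2 by exact: expR_gt0.
exists (Num.bound (N1 + N2)) => k Nk.
have : N1 + N2 < k.+1%:R.
  apply: lt_le_trans (archi_boundP _) _; first by lra.
  by rewrite ler_nat (leq_trans Nk).
set t : R := k.+1%:R => tN; have t0 : 0 < t by rewrite ltr0n.
pose d := Num.sqrt (A / t).
have At0 : 0 < A / t by rewrite divr_gt0.
have d_gt0 : 0 < d by rewrite sqrtr_gt0.
have d2 : d ^+ 2 = A / t by rewrite sqr_sqrtr // ltW.
have dd0 : d <= d0.
  rewrite -(@ler_pXn2r _ 2) ?nnegrE ?(ltW d_gt0) ?(ltW d00) // d2.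
  rewrite ler_pdivrMr // -ler_pdivrMl ?exprn_gt0 // mulrC.
  by have := ltW N20; rewrite -/N1; lra.
have vd1 : v + d <= 1 by rewrite /d0 in dd0; lra.
apply: le_trans (Exp_U_overbid k (ltW v_gt0) d_gt0 vd1).
rewrite d2; set P := Exp _ _ _ _ _ _.
have lam0 := lam_gt0.
(* Losing half the probability turns [cf / (4 * lam)] into [cf / (8 * lam)]. *)
suff P12 : P <= 1 / 2.
  rewrite (_ : _ / t = cf / (4 * lam) * (A / t) * (1 / 2)); last first.
    by field; lra.
  apply: ler_wpM2l; last by lra.
  by rewrite mulr_ge0 // ?(ltW At0) // divr_ge0 ?(ltW cf0) // mulr_ge0 // ltW.
have w01 : 0 < v + d < 1 by rewrite /d0 in dd0; lra.
have w01' : 0 <= v + d <= 1 by lra.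
have v01 : 0 <= v <= 1 by lra.
have := underbid_change_of_measure (bstar (v + d) F) k v01 w01; rewrite -/P.
have := ubP (v + d) k w01'; set Q := Exp _ _ _ _ _ _; rewrite -/t => Qt.
have r0 : 0 <= bern_ratio v (v + d) by apply: le_trans (bern_ratio_ge1 v w01).
(* The ratio is at most [1 + d ^+ 2 / q], hence at most [expR (d ^+ 2 / q)], and
   [k * d ^+ 2 <= A]. *)
have rexp : bern_ratio v (v + d) ^+ k <= expR (A / q).
  have rd : bern_ratio v (v + d) <= expR (d ^+ 2 / q).
    apply: le_trans (expR_ge1Dx _); rewrite bern_ratioE // lerD2l opprD addNKr sqrrN.
    rewrite ler_wpM2l ?sqr_ge0 // lef_pV2 ?posrE // ?mulr_gt0 //; try lra.
    rewrite /q; rewrite /d0 in dd0; nra.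
  apply: (@le_trans _ _ (expR (d ^+ 2 / q) ^+ k)).
    by rewrite lerXn2r ?nnegrE // ltW // expR_gt0.
  rewrite -expRM_natl ler_expR d2 mulrA ler_pM2r ?invr_gt0 //.
  rewrite mulrCA ler_piMr ?(ltW A0) // ler_pdivrMr // mul1r ler_nat //.
have tgam : expR (A / q) * t `^ (- gamma) <= 1 / 4.
  rewrite /powR gt_eqF // -expRD.
  rewrite -[leRHS]lnK ?posrE ?divr_gt0 // ler_expR mul1r lnV ?posrE //.
  have : (A / q + ln 4) / gamma <= ln t.
    rewrite -[leLHS]expRK ler_ln ?posrE ?expR_gt0 // -/N2; lra.
  rewrite ler_pdivrMr // => h; lra.
move=> PQ.
have Q0 : Q <= t `^ (- gamma) by exact: ltW.
have P14 : P ^+ 2 <= 1 / 4.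
  apply: le_trans PQ _; apply: le_trans tgam.
  apply: (@le_trans _ _ (bern_ratio v (v + d) ^+ k * t `^ (- gamma))).
    by rewrite ler_wpM2l // exprn_ge0.
  by rewrite ler_wpM2r // powR_ge0.
nra.
Qed.

End environment.

(** * Harmonic sums and the limit inferior *)

Lemma le_limn_einf (R : realType) (u : (\bar R)^nat) (l : \bar R) (N : nat) :
  (forall n, (N <= n)%N -> (l <= u n)%E) -> (l <= limn_einf u)%E.
Proof.
move=> lu; rewrite limn_einf_lim; apply: lime_ge; first exact: is_cvg_einfs.
exists N => // n /= Nn; apply: le_ereal_inf_tmp => _ [m /= nm <-].
by apply: lu; exact: leq_trans nm.
Qed.

(** Telescoping [ln (1 + 1 / t) <= 1 / t]. *)
Lemma ln_le_harmonic (R : realType) (N n : nat) :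
  ln ((N + n).+1%:R : R) - ln N.+1%:R <= \sum_(N <= k < N + n) k.+1%:R^-1.
Proof.
elim: n => [|n IH]; first by rewrite addn0 subrr big_geq.
rewrite addnS big_nat_recr ?leq_addr //=.
have t0 : 0 < (N + n).+1%:R :> R by rewrite ltr0n.
suff : ln ((N + n).+2%:R : R) - ln (N + n).+1%:R <= (N + n).+1%:R^-1.
  by move=> h; apply: le_trans (lerD IH h); rewrite [leRHS]addrC subrKA.
rewrite -ln_div ?posrE ?ltr0n //.
rewrite -[(N + n).+2]addn1 natrD mulrDl divff ?gt_eqF // mul1r.
by apply: le_ln1Dx; apply: lt_trans (ltrN10 _) _; rewrite invr_gt0.
Qed.

(** Dropping the first [N] terms costs [ln N.+1], at most half of [ln T] once [T] reaches
    [N.+2 ^ 2]; the factor 2 pays for it. *)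
Lemma sum_harmonic_ge_ln (R : realType) (u : nat -> R) (M : R) (N : nat) :
  0 <= M -> (forall k, 0 <= u k) ->
  (forall k, (N <= k)%N -> 2 * M / k.+1%:R <= u k) ->
  forall T, (N.+2 ^ 2 <= T)%N -> M <= (\sum_(k < T) u k) / ln T%:R.
Proof.
move=> M0 u0 uN T NT.
have NT' : (N <= T)%N by lia.
have T1 : (1 < T)%N by lia.
have lnT : 0 < ln (T%:R : R) by rewrite ln_gt0 // ltr1n.
rewrite ler_pdivlMr // -(big_mkord xpredT) (big_cat_nat (n := N)) //=.
apply: ler_wpDl; first by rewrite sumr_ge0.
have lnN : 2 * ln (N.+1%:R : R) <= ln T%:R.
  rewrite mulr_natl -lnXn ?ltr0n // ler_ln ?posrE ?exprn_gt0 ?ltr0n //; last by lia.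
  by rewrite -natrX ler_nat; lia.
have lnT1 : ln (T%:R : R) <= ln T.+1%:R.
  by rewrite ler_ln ?posrE ?ltr0n ?ler_nat //; lia.
have := ln_le_harmonic R N (T - N); rewrite subnKC // => lnH.
apply: (@le_trans _ _ (2 * M * \sum_(N <= k < T) k.+1%:R^-1)).
  rewrite (mulrC 2) -mulrA ler_wpM2l //.
  suff : ln (T%:R : R) <= 2 * (ln T.+1%:R - ln N.+1%:R).
    by move=> h; apply: le_trans h _; rewrite ler_wpM2l.
  move: lnN lnT1; set a := ln _; set b := ln T%:R; set c := ln _; lra.
rewrite mulr_sumr ler_sum_nat // => k /andP[Nk _].
exact: uN.
Qed.

Theorem theorem4 (R : realType) (lam cf Cf : R) (s : strategy R) :
  admissible s ->
  (forall v (F f : R -> R), env_class lam cf Cf v F f ->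
     forall a : R, 0 < a ->
       exists (C : R) (T0 : nat), forall T : nat, (T0 <= T)%N ->
         `|regret s v F f T| <= C * (T%:R `^ a)) ->
  (exists gamma : R, 0 < gamma /\
     forall v (F f : R -> R), env_class lam cf Cf v F f ->
       forall k : nat, prob_underbid s v F f k < (k.+1)%:R `^ (- gamma)) ->
  forall v (F f : R -> R), env_class lam cf Cf v F f ->
    ((cf ^+ 2 * lam ^+ 2 * (v * (1 - v) * (v - bstar v F)) / 32)%:E
       <= limn_einf (fun T : nat => (regret s v F f T / ln T%:R)%:E))%E.
Proof.
move=> [s01 ms] _ [gamma [gamma0 ubP]] v F f env.
have msb : hist_measurable (s F) by move=> n o; exact: ms.
(* The class restricts the mean only to [0, 1], so the underbidding constraint holds for the same
   [F] at every [w]. *)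
have env' w : 0 <= w <= 1 -> env_class lam cf Cf w F f by case: env => _ ? ?; split.
have v01 : 0 <= v <= 1 by case: env.
pose u k := Umax v F - expected_utility s v F f k.
have u0 k : 0 <= u k by rewrite subr_ge0; exact: (Exp_U_le_Umax env msb).
have regretE T : regret s v F f T = \sum_(k < T) u k.
  by rewrite /regret /u sumrB sumr_const card_ord mulr_natl.
set L := _ / 32.
(* At [v] = 0 or 1 the bound is 0 and nonnegative regret suffices. *)
have [v_in|v_out] := boolP (0 < v < 1); last first.
  have -> : L = 0.
    rewrite /L; have [->|->] : v = 0 \/ v = 1 by lra.
      by rewrite !(mul0r, mulr0).
    by rewrite subrr !(mul0r, mulr0).
  apply: (@le_limn_einf _ _ _ 1%N) => T T1.
  by rewrite lee_fin regretE divr_ge0 ?sumr_ge0 // ln_ge0 // ler1n.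
have cf0 : 0 < cf by case: env => _ [_ [_ [_ [_ []]]]].
have lam0 := lam_gt0 env.
(* Chosen so that [cf / (8 * lam) * A] is twice [|L| + 1], a positive number above [L]. *)
pose A := (`|L| + 1) * 16 * lam / cf.
have A0 : 0 < A by rewrite divr_gt0 // !mulr_gt0 // ltr_wpDl.
have ub w k : 0 <= w <= 1 ->
    Exp (s F) w f k [::] (underbid (s F) (bstar w F)) < k.+1%:R `^ (- gamma).
  by move=> w01; exact: ubP (env' _ w01) k.
have [N uN] := Exp_U_gap env msb (s01 F) v_in gamma0 A0 ub.
apply: (@le_limn_einf _ _ _ (N.+2 ^ 2)%N) => T NT.
rewrite lee_fin regretE.
apply: (@le_trans _ _ (`|L| + 1)).
  by apply: le_trans (ler_norm _) _; rewrite lerDl.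
apply: (sum_harmonic_ge_ln (N := N)) => // k Nk.
apply: le_trans (uN k Nk); rewrite (_ : cf / _ * A = 2 * (`|L| + 1)) //.
by rewrite /A; field; lra.
Qed.
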